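(* Let $t\geq 2$ be an integer and $\mathcal{H}=\mathrm{Forb}(K_{2,t})$. Then for all $p\in[0,1]$, $$\mathrm{ed}_{\mathcal{H}}(p)\leq\frac{3p+1}{5+t}.$$
   Context: All graphs are finite and simple. $K_{2,t}$ is the complete bipartite graph with parts of sizes $2$ and $t$. For a graph $H$, $\mathrm{Forb}(H)$ is the hereditary property consisting of all graphs with no induced subgraph isomorphic to $H$. For graphs $G,G'$ on the same labeled vertex set, $\mathrm{dist}(G,G')=|E(G)\,\Delta\, E(G')|$; for a hereditary property $\mathcal{H}$ (a set of graphs closed under isomorphism and vertex deletion), $\mathrm{dist}(G,\mathcal{H})=\min\{\mathrm{dist}(G,G'): G'\in\mathcal{H},\ V(G')=V(G)\}$. The edit distance function is $$\mathrm{ed}_{\mathcal{H}}(p)=\lim_{n\to\infty}\max\left\{\mathrm{dist}(G,\mathcal{H}): |V(G)|=n,\ |E(G)|=\left\lfloor p\tbinom n2\right\rfloor\right\}\Big/\tbinom n2,\qquad p\in[0,1].$$ (The limit is known to exist, and the function is known to be continuous and concave.) *)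

(* Defs.v *)
From HB Require Import structures.
From mathcomp Require Import all_boot all_order all_algebra.
From mathcomp Require Import all_classical all_reals all_analysis.

Set Implicit Arguments.
Unset Strict Implicit.
Unset Printing Implicit Defensive.

Import Order.TTheory GRing.Theory Num.Theory.
Import numFieldNormedType.Exports.

Local Open Scope ring_scope.

Record sgraph (T : finType) := SGraph {
  edges : {set {set T}};
  _ : [forall e in edges, #|e| == 2%N]
}.

HB.instance Definition _ (T : finType) := [isSub for @edges T].
HB.instance Definition _ (T : finType) := [Finite of sgraph T by <:].

Definition adj (T : finType) (G : sgraph T) (x y : T) : bool :=
  [set x; y] \in edges G.

Lemma card_edge (T : finType) (G : sgraph T) (e : {set T}) :
  e \in edges G -> #|e| = 2%N.
Proof. by move=> eG; apply/eqP; move/forall_inP: (valP G); apply. Qed.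

Lemma adj_sym (T : finType) (G : sgraph T) : symmetric (adj G).
Proof. by move=> x y; rewrite /adj finset.setUC. Qed.

Lemma adj_irrefl (T : finType) (G : sgraph T) : irreflexive (adj G).
Proof. by move=> x; apply/negP => /card_edge; rewrite finset.setUid cards1. Qed.

Definition induced_embedding (U T : finType) (H : sgraph U) (G : sgraph T)
    (f : U -> T) : Prop :=
  injective f /\ forall x y, adj G (f x) (f y) = adj H x y.

(* H is isomorphic to an induced subgraph of G, namely to the subgraph of G
   induced by the image of f. *)
Definition induced_in (U T : finType) (H : sgraph U) (G : sgraph T) : Prop :=
  exists f : U -> T, induced_embedding H G f.

Definition graph_property := forall T : finType, sgraph T -> Prop.

(* Closure under isomorphism and vertex deletion in one condition: an induced
   embedding is an isomorphism onto an induced subgraph, and induced subgraphs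
   are what vertex deletions produce. *)
Definition hereditary (P : graph_property) : Prop :=
  forall (U T : finType) (H : sgraph U) (G : sgraph T),
    induced_in H G -> P T G -> P U H.

Definition Forb (U : finType) (H : sgraph U) : graph_property :=
  fun T G => ~ induced_in H G.

Lemma hereditary_Forb (U : finType) (H : sgraph U) : hereditary (Forb H).
Proof.
move=> V T K G [g [g_inj gP]] HG [f [f_inj fP]]; apply: HG.
exists (g \o f); split; first exact: inj_comp.
by move=> x y /=; rewrite gP fP.
Qed.

Definition complete_bipartite_edges (m n : nat) : {set {set 'I_m + 'I_n}} :=
  [set [set inl ij.1; inr ij.2] | ij : 'I_m * 'I_n].

Fact complete_bipartite_subproof (m n : nat) :
  [forall e in complete_bipartite_edges m n, #|e| == 2%N].
Proof. by apply/forall_inP => _ /imsetP[ij _ ->]; rewrite cards2. Qed.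

Definition complete_bipartite (m n : nat) : sgraph ('I_m + 'I_n)%type :=
  SGraph (complete_bipartite_subproof m n).

Definition edit_dist (T : finType) (G G' : sgraph T) : nat :=
  #|(edges G :\: edges G') :|: (edges G' :\: edges G)|.

(* The minimum over the graphs with property P on the vertex set of G.  The
   default value #|T| choose 2 is an upper bound for all the distances, hence
   only matters when no graph on T has property P. *)
Definition dist_to (P : graph_property) (T : finType) (G : sgraph T) : nat :=
  \big[minn/'C(#|T|, 2)]_(G' : sgraph T | `[< P T G' >]) edit_dist G G'.

Definition max_dist (R : realType) (P : graph_property) (p : R) (n : nat) : nat :=
  \max_(G : sgraph 'I_n | #|edges G|%:Z == Num.floor (p * 'C(n, 2)%:R))
    dist_to P G.

(* limn is only meaningful for a convergent sequence; for P hereditary (and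
   satisfied by graphs of every order) and p in [0, 1] the limit exists. *)
Definition ed (R : realType) (P : graph_property) (p : R) : R :=
  limn (fun n : nat => (max_dist P p n)%:R / 'C(n, 2)%:R : R).

(* Main.v *)
(** Cut the vertices of [G] into [k] parts, force some pairs of parts to be
    empty (colour [Some false]) and some to be complete ([Some true]), and leave
    the other pairs alone ([None]).  For a uniformly random map to the parts, if
    there are [w] empty and [b] complete ordered pairs of parts, the expected
    number of edits is [(w |E| + b (C(n,2) - |E|)) / k^2].

    For [t <= 3] take three parts, two of them forming an independent set and
    the third a clique ([w = 4], [b = 1]): the result is a split graph, so it has
    no induced 4-cycle.  For [t >= 4] take [k = t + 5] cliques arranged in a
    cycle, with no edges between parts at cyclic distance 1 or 2 ([w = 4k],
    [b = k]).  In an induced [K_{2,t}] the [t] independent vertices lie in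
    distinct parts that are not at distance 1 or 2 from either of the two parts
    of the other side; as these two parts exclude at least 6 parts, only
    [t - 1] remain.  In both cases the expected number of edits is
    at most [(3 |E| + C(n,2)) / (t + 5)]; the first denominator is [9 > t + 5]. *)
Require Import Defs.
From mathcomp Require Import all_boot all_order all_algebra.
From mathcomp Require Import all_classical all_reals all_analysis.
From mathcomp Require Import zify.

Import Order.TTheory GRing.Theory Num.Theory.
Import numFieldNormedType.Exports.

Set Implicit Arguments.
Unset Strict Implicit.
Unset Printing Implicit Defensive.

Local Open Scope ring_scope.

(** * Graphs given by relations *)

Section RelationGraph.
Variables (T : finType) (r : rel T).

Definition rel_edges : {set {set T}} :=
  [set [set xy.1; xy.2] | xy : T * T & (xy.1 != xy.2) && r xy.1 xy.2].

Fact rel_graph_subproof : [forall e in rel_edges, #|e| == 2%N].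
Proof.
apply/forall_inP => _ /imsetP[xy /[!inE] /andP[xyN _] ->].
by rewrite cards2 xyN.
Qed.

Definition rel_graph : sgraph T := SGraph rel_graph_subproof.

Lemma adj_rel_graph : symmetric r ->
  forall x y, adj rel_graph x y = (x != y) && r x y.
Proof.
move=> r_sym x y; apply/imsetP/idP => [[[u v]]|xy]; last first.
  by exists (x, y); rewrite ?inE.
rewrite inE /= => /andP[uv ruv] exy.
have xNy : x != y.
  by have := cards2 x y; rewrite exy cards2 uv; case: (x != y).
rewrite xNy /=.
have : x \in [set u; v] by rewrite -exy !inE eqxx.
have : y \in [set u; v] by rewrite -exy !inE eqxx orbT.
rewrite !inE => /orP[] /eqP yE /orP[] /eqP xE; move: xNy ruv; rewrite xE yE ?eqxx //.
by rewrite r_sym.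
Qed.

End RelationGraph.

Lemma card_edges_le (T : finType) (G : sgraph T) : (#|edges G| <= 'C(#|T|, 2))%N.
Proof.
rewrite -card_draws; apply: subset_leq_card; apply/fintype.subsetP => e /card_edge eE.
by rewrite inE eE.
Qed.

Lemma dist_to_le (P : graph_property) (T : finType) (G G' : sgraph T) :
  P T G' -> (dist_to P G <= edit_dist G G')%N.
Proof.
by move=> PG'; apply: (@bigmin_le_cond _ nat); apply/asboolP.
Qed.

(** * Averages over all maps to the parts *)

Section RandomMap.
Variables (T K : finType) (x y : T).
Hypothesis xNy : x != y.

(** Two values are prescribed and the other [#|T| - 2] are free; multiplying by [#|K| ^ 2] avoids a
    subtraction in the exponent. *)
Lemma card_fiber2 (i j : K) :
  (#|[set f : {ffun T -> K} | (f x, f y) == (i, j)]| * #|K| ^ 2 = #|K| ^ #|T|)%N.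
Proof.
pose F z : pred K := if z == x then pred1 i else if z == y then pred1 j else predT.
have -> : #|[set f : {ffun T -> K} | (f x, f y) == (i, j)]| = #|family F|.
  apply: eq_card => f; rewrite !inE; apply/idP/familyP => [/eqP[fx fy] z|fF].
    rewrite /F; case: eqP => [->|_]; first by rewrite inE fx.
    by case: eqP => [->|_]; rewrite inE ?fy.
  have := fF x; have := fF y; rewrite /F eqxx eq_sym (negbTE xNy) eqxx !inE.
  by move=> /eqP-> /eqP->.
have -> : #|family F| = (\prod_z #|F z|)%N.
  by rewrite card_family foldrE big_map big_enum.
rewrite (bigD1 x) //= (bigD1 y) 1?eq_sym //= {1 2}/F eqxx eq_sym (negbTE xNy) eqxx !card1 !mul1n.
rewrite (eq_bigr (fun=> #|K|)) => [|z /andP[zx zy]]; last first.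
  by rewrite /F (negbTE zx) (negbTE zy).
rewrite prod_nat_const -expnD; congr (_ ^ _)%N.
have -> : #|[pred z | (z != x) && (z != y)]| = #|~: [set x; y]|.
  by apply: eq_card => z; rewrite !inE negb_or.
by rewrite -(cardsC [set x; y]) cards2 xNy addnC.
Qed.

Lemma sum_ffun_pair (F : K -> K -> nat) :
  ((\sum_(f : {ffun T -> K}) F (f x) (f y)) * #|K| ^ 2 =
   #|K| ^ #|T| * \sum_i \sum_j F i j)%N.
Proof.
rewrite pair_big /= (partition_big (fun f : {ffun T -> K} => (f x, f y)) predT) //=.
rewrite big_distrl big_distrr /=; apply: eq_bigr => -[i j] _ /=.
rewrite (eq_bigr (fun=> F i j)) => [|f /eqP[-> ->] //].
rewrite sum_nat_const -(card_fiber2 i j) mulnAC; congr (_ * _ * _)%N.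
by apply: eq_card => f; rewrite !inE.
Qed.

End RandomMap.

(** * Recolouring a graph along a map to the parts *)

Section Recolor.
Variables (T K : finType) (c : K -> K -> option bool).
Hypothesis c_sym : forall i j, c i j = c j i.
Variable G : sgraph T.

Definition recolor (f : {ffun T -> K}) : sgraph T :=
  rel_graph (fun x y => odflt (adj G x y) (c (f x) (f y))).

Lemma adj_recolor f x y :
  adj (recolor f) x y = (x != y) && odflt (adj G x y) (c (f x) (f y)).
Proof.
by apply: adj_rel_graph => u v; rewrite c_sym adj_sym.
Qed.

(** The pairs are ordered and include the diagonal, since two vertices may land in the same part. *)
Definition color_count (b : bool) : nat :=
  (\sum_i \sum_j (c i j == Some b))%N.

(** A pair is edited exactly when its colour forces the opposite of its status in [G]: edges pay for
    [Some false], non-edges for [Some true]. *)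
Lemma sum_recolor_pair (e : {set T}) : #|e| == 2%N ->
  ((\sum_f (e \in (edges G :\: edges (recolor f)) :|:
                  (edges (recolor f) :\: edges G))) * #|K| ^ 2 =
   #|K| ^ #|T| * color_count (e \notin edges G))%N.
Proof.
case/cards2P => x [y] [xNy ->].
set b := (X in color_count X).
rewrite /color_count -(sum_ffun_pair xNy (fun i j => (c i j == Some b : nat))).
congr (_ * _)%N; apply: eq_bigr => f _; congr nat_of_bool.
rewrite {}/b; have := adj_recolor f x y; rewrite /adj xNy !inE /= => ->.
by case: (c _ _) => [[]|] /=; case: (_ \in edges G).
Qed.

Lemma sum_edit_dist_recolor :
  ((\sum_f edit_dist G (recolor f)) * #|K| ^ 2 =
   #|K| ^ #|T| * (color_count false * #|edges G| +
                  color_count true * ('C(#|T|, 2) - #|edges G|)))%N.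
Proof.
pose D := [set e : {set T} | #|e| == 2%N].
have EsubD (H : sgraph T) : edges H \subset D.
  by apply/fintype.subsetP => e /card_edge eE; rewrite inE eE.
have distE f : edit_dist G (recolor f) =
  (\sum_(e in D) (e \in (edges G :\: edges (recolor f)) :|:
                        (edges (recolor f) :\: edges G)))%N.
  rewrite /edit_dist -sum1_card big_mkcond [RHS]big_mkcond /=.
  apply: eq_bigr => e _; case: ifP => [eD|_]; last by case: ifP.
  rewrite inE (_ : #|e| == 2%N) //; apply/eqP.
  by case/finset.setUP: eD => /finset.setDP[eE _];
    [apply: (@card_edge _ G) | apply: (@card_edge _ (recolor f))].
rewrite (eq_bigr _ (fun f _ => distE f)) exchange_big /= big_distrl /=.
rewrite (eq_bigr (fun e => #|K| ^ #|T| * color_count (e \notin edges G)))%N; last first.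
  by move=> e; rewrite inE => /sum_recolor_pair.
rewrite -big_distrr /=; congr (_ * _)%N.
rewrite (big_setID (edges G)) /= (finset.setIidPr (EsubD G)).
congr (_ + _)%N.
  by rewrite (eq_bigr (fun=> color_count false)) => [|e ->//]; rewrite sum_nat_const mulnC.
rewrite (eq_bigr (fun=> color_count true)) => [|e]; last by rewrite inE => /andP[-> _].
rewrite sum_nat_const mulnC; congr (_ * _)%N.
by rewrite cardsD (finset.setIidPr (EsubD G)) card_draws.
Qed.

(** Some map does no worse than the average: otherwise each of the [#|K| ^ #|T|] terms would reach
    [M.+1], and the sum would be too large. *)
Lemma exists_recolor : (0 < #|K|)%N ->
  exists f, (#|K| ^ 2 * edit_dist G (recolor f) <=
    color_count false * #|edges G| +
    color_count true * ('C(#|T|, 2) - #|edges G|))%N.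
Proof.
move=> K_gt0; apply: contrapT => noF; have := sum_edit_dist_recolor.
set M := (color_count false * _ + _)%N => sumE.
have : (#|K| ^ #|T| * M.+1 <= (\sum_f edit_dist G (recolor f)) * #|K| ^ 2)%N.
  rewrite -card_ffun -sum_nat_const big_distrl /=; apply: leq_sum => f _.
  by rewrite ltnNge mulnC; apply/negP => fM; apply: noF; exists f.
by rewrite sumE leq_pmul2l ?expn_gt0 ?K_gt0 // ltnn.
Qed.

End Recolor.

(** * Complete bipartite graphs and the split colouring *)

Lemma adj_complete_bipartite_lr (m n : nat) (i : 'I_m) (j : 'I_n) :
  adj (complete_bipartite m n) (inl i) (inr j).
Proof. by apply/imsetP; exists (i, j). Qed.

Lemma adj_complete_bipartite_ll (m n : nat) (i i' : 'I_m) :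
  adj (complete_bipartite m n) (inl i) (inl i') = false.
Proof.
apply/negP => /imsetP[[u v] _ /= e].
have : inr v \in [set inl i; inl i'] by rewrite e !inE eqxx orbT.
by rewrite !inE.
Qed.

Lemma adj_complete_bipartite_rr (m n : nat) (j j' : 'I_n) :
  adj (complete_bipartite m n) (inr j) (inr j') = false.
Proof.
apply/negP => /imsetP[[u v] _ /= e].
have : inl u \in [set inr j; inr j'] by rewrite e !inE eqxx.
by rewrite !inE.
Qed.

Definition split_color (i j : 'I_3) : option bool :=
  if (i < 2)%N && (j < 2)%N then Some false
  else if (2 <= i)%N && (2 <= j)%N then Some true else None.

Lemma split_color_sym i j : split_color i j = split_color j i.
Proof. by rewrite /split_color [(i < 2)%N && _]andbC [(2 <= i)%N && _]andbC. Qed.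

Lemma split_color_count b : color_count split_color b = if b then 1%N else 4%N.
Proof.
by rewrite /color_count !big_ord_recl !big_ord0; case: b.
Qed.

(** Each side contains two non-adjacent vertices, which cannot both lie in the clique part. So each
    side has a vertex in the independent parts, yet these two are adjacent. *)
Lemma Forb_recolor_split (t : nat) (T : finType) (G : sgraph T) f : (2 <= t)%N ->
  Forb (complete_bipartite 2 t) (recolor split_color G f).
Proof.
move=> t2 [g [g_inj gP]].
have adjE := adj_recolor split_color_sym G f.
pose b0 : 'I_t := Ordinal (ltnW t2); pose b1 : 'I_t := Ordinal t2.
have clique u v : u != v -> adj (complete_bipartite 2 t) u v = false ->
    (2 <= f (g u))%N -> (2 <= f (g v))%N -> False.
  move=> uv; rewrite -gP adjE (inj_eq g_inj) uv /= /split_color => + fu fv.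
  by rewrite ![(_ < 2)%N]ltnNge fu fv.
have indep u v : adj (complete_bipartite 2 t) u v ->
    (f (g u) < 2)%N -> (f (g v) < 2)%N -> False.
  by rewrite -gP adjE /split_color => + fu fv; rewrite fu fv andbF.
have [a fa] : exists a : 'I_2, (f (g (inl a)) < 2)%N.
  have [|h0] := ltnP (f (g (inl ord0))) 2; first by exists ord0.
  have [|h1] := ltnP (f (g (inl ord_max))) 2; first by exists ord_max.
  by have := clique _ _ _ (adj_complete_bipartite_ll _ _ _) h0 h1; case.
have [b fb] : exists b : 'I_t, (f (g (inr b)) < 2)%N.
  have [|h0] := ltnP (f (g (inr b0))) 2; first by exists b0.
  have [|h1] := ltnP (f (g (inr b1))) 2; first by exists b1.
  by have := clique _ _ _ (adj_complete_bipartite_rr _ _ _) h0 h1; case.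
exact: indep (adj_complete_bipartite_lr a b) fa fb.
Qed.

(** * The circulant colouring *)

Section Circulant.
Variable k : nat.

(** Here [d] is the absolute difference, as one of the truncated subtractions vanishes; [k - 1] and
    [k - 2] account for going around the cycle. *)
Definition cyclic_near (i j : nat) : bool :=
  let d := ((i - j) + (j - i))%N in
  [|| d == 1, d == 2, d == k - 1 | d == k - 2]%N.

Definition cyclic_color (i j : 'I_k) : option bool :=
  if i == j then Some true else if cyclic_near i j then Some false else None.

(** Reduction modulo [k] for sums of two residues, in a form that stays within linear arithmetic. *)
Definition wrap n : nat := if (n < k)%N then n else (n - k)%N.

Lemma wrapP n : (n < k)%N && (wrap n == n) || (k <= n)%N && (wrap n + k == n)%N.
Proof. by rewrite /wrap; case: ltnP => kn; lia. Qed.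

Lemma wrapD0 u : (u < k)%N -> u = wrap (u + 0).
Proof. by rewrite /wrap addn0 => ->. Qed.

Lemma wrapD_inj u a b : (u < k)%N -> (a < k)%N -> (b < k)%N ->
  wrap (u + a) = wrap (u + b) -> a = b.
Proof. by have := wrapP (u + a); have := wrapP (u + b); lia. Qed.

Lemma wrapD_surj u v : (u < k)%N -> (v < k)%N -> exists2 a, (a < k)%N & v = wrap (u + a).
Proof.
move=> uk vk; have [uv|vu] := leqP u v.
  by exists (v - u)%N; rewrite ?subnKC // /wrap ?vk //; lia.
by exists (v + k - u)%N; have := wrapP (u + (v + k - u)); lia.
Qed.

Lemma cyclic_near_wrapD u a b : (u < k)%N -> (a < k)%N -> (b < k)%N ->
  cyclic_near (wrap (u + a)) (wrap (u + b)) = cyclic_near a b.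
Proof.
move=> uk ak bk; have := wrapP (u + a); have := wrapP (u + b).
by rewrite /cyclic_near; lia.
Qed.

Lemma cyclic_near_sym i j : cyclic_near i j = cyclic_near j i.
Proof. by rewrite /cyclic_near addnC. Qed.

Lemma cyclic_color_sym i j : cyclic_color i j = cyclic_color j i.
Proof. by rewrite /cyclic_color eq_sym cyclic_near_sym. Qed.

Lemma cyclic_color_count_true : color_count cyclic_color true = k.
Proof.
rewrite /color_count (eq_bigr (fun=> 1%N)) => [|i _]; first by rewrite sum1_card card_ord.
rewrite (bigD1 i) //= {1}/cyclic_color eqxx /= big1 ?addn0 // => j ji.
by rewrite /cyclic_color [i == j]eq_sym (negbTE ji); case: cyclic_near.
Qed.

(** By translation the parts near [i] are among the four in [s], which may coincide for small
    [k]. *)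
Lemma cyclic_color_count_false : (color_count cyclic_color false <= 4 * k)%N.
Proof.
rewrite /color_count mulnC -[X in (X * 4)%N]card_ord -sum_nat_const; apply: leq_sum => i _.
pose s := [seq wrap (i + a) | a <- [:: 1; 2; k - 1; k - 2]]%N.
have -> : (\sum_j (cyclic_color i j == Some false) =
    #|[pred j | cyclic_color i j == Some false]|)%N.
  rewrite -sum1_card [RHS]big_mkcond; apply: eq_bigr => j _.
  by rewrite inE; case: (_ == _).
rewrite cardE -(size_map (@nat_of_ord k)) (_ : 4%N = size s) //.
apply: uniq_leq_size; first by rewrite map_inj_uniq ?enum_uniq //; apply: ord_inj.
move=> _ /mapP[j + ->]; rewrite mem_enum inE /cyclic_color.
case: ifP => // _; case: ifP => // + _.
have [a ak ja] := wrapD_surj (ltn_ord i) (ltn_ord j).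
rewrite ja {1}(wrapD0 (ltn_ord i)) cyclic_near_wrapD //; last exact: leq_ltn_trans ak.
move=> near0a; apply/mapP; exists a => //; move: near0a.
by rewrite /cyclic_near !inE; lia.
Qed.

(* The parts near 0 are 1, 2, -1, -2; in each case two of the parts near [d]
   are not among them. *)
Lemma cyclic_near_pair0 d : (9 <= k)%N -> (0 < d < k)%N ->
  exists s : seq nat, [/\ size s = 6%N, uniq s &
    {in s, forall z, (z < k)%N && (cyclic_near 0 z || cyclic_near d z)}].
Proof.
move=> k9 dk; pose s a b := [:: 1; 2; k - 1; k - 2; a; b]%N.
suff [a [b [abs ab6]]] : exists a b, uniq (s a b) /\
  {in s a b, forall z, (z < k)%N && (cyclic_near 0 z || cyclic_near d z)}.
  by exists (s a b).
have [d1|[d2|[d34|[d0|d5]]]] :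
    d = 1%N \/ d = 2%N \/ (3 <= d <= 4)%N \/ d = (k - 1)%N \/ (5 <= d <= k - 2)%N.
  by lia.
- by exists 3%N, 0%N; split=> [|z]; rewrite /s /= !inE /cyclic_near; lia.
- by exists 3%N, 4%N; split=> [|z]; rewrite /s /= !inE /cyclic_near; lia.
- by exists (d + 1)%N, (d + 2)%N; split=> [|z]; rewrite /s /= !inE /cyclic_near; lia.
- by exists 0%N, (k - 3)%N; split=> [|z]; rewrite /s /= !inE /cyclic_near; lia.
- by exists (d - 1)%N, (d - 2)%N; split=> [|z]; rewrite /s /= !inE /cyclic_near; lia.
Qed.

(** Translation by [u] reduces this to the pair 0, [d], and is injective on residues. *)
Lemma card_cyclic_near2 (u v : 'I_k) : (9 <= k)%N -> u != v ->
  (6 <= #|[set z : 'I_k | cyclic_near u z || cyclic_near v z]|)%N.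
Proof.
move=> k9 uNv; have uk := ltn_ord u.
have [d dk vE] := wrapD_surj uk (ltn_ord v).
have d_gt0 : (0 < d)%N.
  by rewrite lt0n; apply: contraNneq uNv => d0; rewrite -val_eqE /= vE d0 -wrapD0.
have [|s [<- s_uniq sP]] := @cyclic_near_pair0 d k9; first by rewrite d_gt0.
rewrite cardE -(size_map (@nat_of_ord k)) -(size_map (fun a => wrap (u + a)) s).
apply: uniq_leq_size => [|_ /mapP[a /sP /andP[ak near_a] ->]].
  rewrite map_inj_in_uniq // => a b /sP /andP[ak _] /sP /andP[bk _].
  exact: wrapD_inj.
have wk : (wrap (u + a) < k)%N by have := wrapP (u + a); lia.
apply/mapP; exists (Ordinal wk) => //; rewrite mem_enum inE /=.
by rewrite vE {1}(wrapD0 uk) !cyclic_near_wrapD //; exact: leq_ltn_trans ak.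
Qed.

End Circulant.

Lemma Forb_recolor_cyclic (t : nat) (T : finType) (G : sgraph T) f : (4 <= t)%N ->
  Forb (complete_bipartite 2 t) (recolor (@cyclic_color (t + 5)) G f).
Proof.
move=> t4 [g [g_inj gP]].
have adjE := adj_recolor (@cyclic_color_sym (t + 5)) G f.
have clique u v : adj (complete_bipartite 2 t) u v = false ->
    f (g u) = f (g v) -> u = v.
  rewrite -gP adjE (inj_eq g_inj) => + fuv; rewrite fuv /cyclic_color eqxx andbT /=.
  by move/negbFE/eqP.
have far u v : adj (complete_bipartite 2 t) u v ->
    ~~ cyclic_near (t + 5) (f (g u)) (f (g v)).
  (* Equal parts have difference 0, which is not near because [t + 5 >= 9]. *)
  rewrite -gP adjE /cyclic_color => /andP[_]; case: eqP => [->|_].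
    by rewrite /cyclic_near; lia.
  by case: cyclic_near.
pose a i : 'I_(t + 5) := f (g (inl i)); pose b j : 'I_(t + 5) := f (g (inr j)).
have b_inj : injective b.
  by move=> j j' /clique-/(_ (adj_complete_bipartite_rr _ _ _))[].
have aNa : a ord0 != a ord_max.
  by apply/eqP => /clique-/(_ (adj_complete_bipartite_ll _ _ _)).
pose N := [set z : 'I_(t + 5) |
  cyclic_near (t + 5) (a ord0) z || cyclic_near (t + 5) (a ord_max) z].
have N6 : (6 <= #|N|)%N by apply: card_cyclic_near2 => //; lia.
(* The [t] distinct parts [b j] would have to fit into at most [t + 5 - 6] parts. *)
have : [set b j | j : 'I_t] \subset ~: N.
  apply/fintype.subsetP => _ /imsetP[j _ ->]; rewrite !inE negb_or.
  by rewrite !far ?adj_complete_bipartite_lr.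
move/subset_leq_card; rewrite card_imset // card_ord.
by have := cardsC N; rewrite card_ord; lia.
Qed.

(** * From finite graphs to the edit distance function *)

Lemma dist_to_Forb_K2t (t : nat) (T : finType) (G : sgraph T) : (2 <= t)%N ->
  (dist_to (Forb (complete_bipartite 2 t)) G * (t + 5) <=
   3 * #|edges G| + 'C(#|T|, 2))%N.
Proof.
(* [EC] makes the subtraction in [exists_recolor] a genuine one. *)
move=> t2; have EC := card_edges_le G.
have [t4|t4] := leqP 4 t.
  have [|f] := exists_recolor (@cyclic_color_sym (t + 5)) G; first by rewrite card_ord; lia.
  have := dist_to_le G (@Forb_recolor_cyclic _ _ G f t4).
  rewrite cyclic_color_count_true card_ord.
  have := cyclic_color_count_false (t + 5).
  move: (dist_to _ _) (edit_dist _ _) (color_count _ _) EC => d e w EC w4 de he.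
  (* Both colour counts carry a factor [t + 5], which cancels one of the two on the left. *)
  have : ((t + 5) * (d * (t + 5)) <= (t + 5) * (3 * #|edges G| + 'C(#|T|, 2)))%N by nia.
  by rewrite leq_pmul2l // addn_gt0 orbT.
have [|f] := exists_recolor split_color_sym G; first by rewrite card_ord.
have := dist_to_le G (@Forb_recolor_split _ _ G f t2).
by rewrite !split_color_count card_ord; nia.
Qed.

Theorem theorem11 (R : realType) (t : nat) (ht : (2 <= t)%N)
  (p : R) (hp : 0 <= p <= 1) :
  ed (Forb (complete_bipartite 2 t)) p <= (3 * p + 1) / (5 + t%:R).
Proof.
have /andP[p0 _] := hp.
have t5 : 0 < 5 + t%:R :> R by rewrite -natrD ltr0n.
have bound_ge0 : 0 <= (3 * p + 1) / (5 + t%:R) by rewrite divr_ge0 ?addr_ge0 ?mulr_ge0.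
rewrite /ed; set u := (X in limn X).
have [u_cvg|u_dvg] := pselect (cvgn u); last first.
  (* the junk value of the limit of a divergent sequence is 0 *)
  by rewrite (dvgP u_dvg).
apply: limr_le => //; apply: nearW => n; rewrite /u.
(* For [n < 2] the quotient is 0, the inverse of 0 being 0. *)
have [C0|C_gt0] := posnP 'C(n, 2); first by rewrite C0 invr0 mulr0.
rewrite ler_pdivrMr ?ltr0n //.
rewrite /max_dist; elim/big_ind: _ => [|a b ha hb|G /eqP EG].
- by rewrite mulr_ge0.
- by rewrite /maxn; case: ifP.
rewrite mulrAC ler_pdivlMr //.
have := dist_to_Forb_K2t G ht; rewrite card_ord -(ler_nat R).
rewrite natrM [(_ + 'C(n, 2))%:R]natrD natrM natrD [t%:R + _]addrC => /le_trans; apply.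
rewrite [(_ + 1) * _]mulrDl mul1r lerD2r -mulrA ler_pM2l ?ltr0n //.
(* The edge count is a floor, hence at most [p * 'C(n, 2)]. *)
by rewrite pmulrn EG floor_le.
Qed.
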